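(* If $K$ is a compact convex subset of $\mathbb{R}^n$ having at least $n+1$ exposed points, then there exists an $n$-dimensional simplex $S$ in $\mathbb{R}^n$ such that for each unit vector $u$ the projection $S_u$ contains a translate of the projection $K_u$, while $S$ does not contain a translate of $K$.
   Context: For a unit vector $u$ and a set $S\subseteq\mathbb{R}^n$, $S_u$ denotes the orthogonal projection onto $u^\perp$. A point $x\in K$ is an exposed point of $K$ if there is a unit vector $u$ such that $x$ is the unique point of $K$ maximizing $y\mapsto y\cdot u$ over $K$. *)

(* Defs.v *)
From HB Require Import structures.
From mathcomp Require Import all_boot all_order all_algebra.
From mathcomp Require Import all_classical all_reals topology normedtype.
Set Implicit Arguments. Unset Strict Implicit. Unset Printing Implicit Defensive.
Import Order.TTheory GRing.Theory Num.Theory.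
Import numFieldNormedType.Exports.
Local Open Scope classical_set_scope.
Local Open Scope ring_scope.

Definition dotv (R : realType) (n : nat) (x y : 'rV[R]_n) : R :=
  \sum_(i < n) x ord0 i * y ord0 i.

Definition unit_vec (R : realType) (n : nat) (u : 'rV[R]_n) : Prop :=
  dotv u u = 1.

(* orthogonal projection onto u^perp (u a unit vector) *)
Definition proj_perp (R : realType) (n : nat) (u x : 'rV[R]_n) : 'rV[R]_n :=
  x - dotv x u *: u.

Definition convex_set (R : realType) (n : nat) (K : set 'rV[R]_n) : Prop :=
  forall x y, K x -> K y -> forall t : R, 0 <= t -> t <= 1 ->
    K ((1 - t) *: x + t *: y).

Definition exposed_point (R : realType) (n : nat) (K : set 'rV[R]_n)
    (x : 'rV[R]_n) : Prop :=
  K x /\ exists u : 'rV[R]_n, unit_vec u /\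
    (forall y, K y -> dotv y u <= dotv x u) /\
    (forall y, K y -> dotv y u = dotv x u -> y = x).

Definition affinely_independent (R : realType) (n : nat)
    (v : 'I_n.+1 -> 'rV[R]_n) : Prop :=
  forall c : 'I_n.+1 -> R, \sum_i c i = 0 -> \sum_i c i *: v i = 0 ->
    forall i, c i = 0.

Definition conv_hull (R : realType) (n : nat) (v : 'I_n.+1 -> 'rV[R]_n)
    : set 'rV[R]_n :=
  [set x | exists c : 'I_n.+1 -> R, (forall i, 0 <= c i) /\ \sum_i c i = 1 /\
     x = \sum_i c i *: v i].

Definition is_simplex (R : realType) (n : nat) (S : set 'rV[R]_n) : Prop :=
  exists v : 'I_n.+1 -> 'rV[R]_n, affinely_independent v /\ S = conv_hull v.

Definition contains_translate (R : realType) (n : nat) (A B : set 'rV[R]_n)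
    : Prop :=
  exists t : 'rV[R]_n, forall x, B x -> A (x + t).

(* Main.v *)
(* Since the faces [F(K, u)] vary semicontinuously with [u], disjointness of
   [F(K, u)] and [F(K, v)] survives small perturbations of [u] and [v].  The
   exposed points give [n + 1] directions [u_i] with sum [0], any [n] of them a
   basis, whose faces [F(K, u_i)] are pairwise disjoint; hence each point of [K]
   is close to at most one facet of the simplex circumscribed to [K] with outer
   normals [u_i].  Pushing all facets inwards by a small [eta] leaves no room for
   [K], as [\sum_i u_i = 0].  But when the points of [K] may also slide along a
   fixed [w], each point has only one facet to avoid, and enough room exists. *)

Require Import Defs.
From HB Require Import structures.
From mathcomp Require Import all_boot all_order all_algebra.
From mathcomp Require Import all_classical all_reals topology normedtype.
From mathcomp Require Import derive.
From mathcomp Require Import ring lra.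
Set Implicit Arguments.
Unset Strict Implicit.
Unset Printing Implicit Defensive.
Import Order.TTheory GRing.Theory Num.Theory.
Import numFieldNormedType.Exports.
Local Open Scope classical_set_scope.
Local Open Scope ring_scope.

(** * Bilinearity and continuity of the dot product *)

Lemma dotvE (R : realType) n (x y : 'rV[R]_n) : dotv x y = (x *m y^T) 0 0.
Proof. by rewrite mxE; apply: eq_bigr => i _; rewrite mxE. Qed.

Lemma dotvC (R : realType) n (x y : 'rV[R]_n) : dotv x y = dotv y x.
Proof. by apply: eq_bigr => i _; rewrite mulrC. Qed.

Lemma dotvDl (R : realType) n (x y z : 'rV[R]_n) :
  dotv (x + y) z = dotv x z + dotv y z.
Proof. by rewrite !dotvE mulmxDl mxE. Qed.

Lemma dotvZl (R : realType) n a (x y : 'rV[R]_n) :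
  dotv (a *: x) y = a * dotv x y.
Proof. by rewrite !dotvE -scalemxAl mxE. Qed.

Lemma dotvNl (R : realType) n (x y : 'rV[R]_n) : dotv (- x) y = - dotv x y.
Proof. by rewrite -scaleN1r dotvZl mulN1r. Qed.

Lemma dotv0l (R : realType) n (y : 'rV[R]_n) : dotv 0 y = 0.
Proof. by rewrite -[0](scale0r y) dotvZl mul0r. Qed.

Lemma dotvDr (R : realType) n (x y z : 'rV[R]_n) :
  dotv x (y + z) = dotv x y + dotv x z.
Proof. by rewrite !(dotvC x) dotvDl. Qed.

Lemma dotvZr (R : realType) n a (x y : 'rV[R]_n) :
  dotv x (a *: y) = a * dotv x y.
Proof. by rewrite !(dotvC x) dotvZl. Qed.

Lemma dotvNr (R : realType) n (x y : 'rV[R]_n) : dotv x (- y) = - dotv x y.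
Proof. by rewrite !(dotvC x) dotvNl. Qed.

Lemma dotv_suml (R : realType) n (I : finType) (F : I -> 'rV[R]_n) y :
  dotv (\sum_i F i) y = \sum_i dotv (F i) y.
Proof.
apply: (big_morph (fun x => dotv x y)) => [a b|]; first exact: dotvDl.
exact: dotv0l.
Qed.

Lemma dotv_sumr (R : realType) n (I : finType) x (F : I -> 'rV[R]_n) :
  dotv x (\sum_i F i) = \sum_i dotv x (F i).
Proof. by rewrite dotvC dotv_suml; apply: eq_bigr => i _; rewrite dotvC. Qed.

Lemma dotv_continuous (R : realType) n (u : 'rV[R]_n) :
  continuous (fun x => dotv x u).
Proof.
apply: (@continuous_big _ _ +%R) => [|i _]; first exact: add_continuous.
by move=> x; apply: continuousM; [exact: coord_continuous|exact: cst_continuous].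
Qed.

(** * Faces of [K] and their disjointness *)

(** The points of the face [F(K, u)]; [u] need not be a unit vector, so directions can be added,
    scaled and perturbed. *)
Definition maximizer (R : realType) n (K : set 'rV[R]_n) u x :=
  K x /\ forall y, K y -> dotv y u <= dotv x u.

Definition disjoint_faces (R : realType) n (K : set 'rV[R]_n) u v :=
  forall x, maximizer K u x -> ~ maximizer K v x.

Lemma maximizer_exists (R : realType) n (K : set 'rV[R]_n) u :
  compact K -> K !=set0 -> exists x, maximizer K u x.
Proof.
move=> cK K0.
have [|x /set_mem Kx mx] := compact_EVT_max K0 cK (f := fun x => dotv x u).
  exact/continuous_subspaceT/dotv_continuous.
by exists x; split=> // y /mem_set; exact: mx.
Qed.

Lemma maximizerZ (R : realType) n (K : set 'rV[R]_n) a u x :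
  0 < a -> maximizer K (a *: u) x -> maximizer K u x.
Proof.
by move=> a0 [Kx mx]; split=> // y /mx; rewrite !dotvZr ler_pM2l.
Qed.

Lemma disjoint_faces_sym (R : realType) n (K : set 'rV[R]_n) u v :
  disjoint_faces K u v -> disjoint_faces K v u.
Proof. by move=> D x mv mu; exact: D mu mv. Qed.

(** If the maximum of [u + v] over [K] reached the sum of the separate maxima, a point attaining it
    would lie in both faces; [e] is the difference. *)
Lemma disjoint_faces_gap (R : realType) n (K : set 'rV[R]_n) u v p q :
  compact K -> maximizer K u p -> maximizer K v q -> disjoint_faces K u v ->
  exists2 e, 0 < e &
    forall x, K x -> dotv x u + dotv x v + e <= dotv p u + dotv q v.
Proof.
move=> cK [Kp mp] [Kq mq] D.
have [|z [Kz mz]] := maximizer_exists (u + v) cK; first by exists p.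
exists (dotv p u + dotv q v - dotv z (u + v)) => [|x /mz]; last first.
  by rewrite !dotvDr => ?; lra.
rewrite subr_gt0 ltNge dotvDr; apply/negP => le_pq.
have zu := mp _ Kz; have zv := mq _ Kz.
apply: (D z); split=> // y Ky.
  by have := mp _ Ky; lra.
by have := mq _ Ky; lra.
Qed.

(** A common maximizer of the perturbed directions does at least as well as [p] and [q], so its
    total deficit in [u] and [v] is at most [s * C], less than the gap [e] for small [s]. *)
Lemma disjoint_faces_near (R : realType) n (K : set 'rV[R]_n) u v du dv :
  compact K -> K !=set0 -> disjoint_faces K u v ->
  \forall s \near 0^'+, disjoint_faces K (u + s *: du) (v + s *: dv).
Proof.
move=> cK K0 D.
have [p mp] := maximizer_exists u cK K0.
have [q mq] := maximizer_exists v cK K0.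
have [z [_ mz]] := maximizer_exists (du + dv) cK K0.
have [e e0 gap] := disjoint_faces_gap cK mp mq D.
have [[Kp _] [Kq _]] := (mp, mq).
pose C := dotv z (du + dv) - dotv p du - dotv q dv.
near=> s => x [Kx xu] [_ xv].
have s0 : 0 < s by near: s; exact: nbhs_right_gt.
have sC : s < e / (`|C| + 1).
  by near: s; apply: nbhs_right_lt; rewrite divr_gt0 // ltr_wpDl.
have {sC} : s * (`|C| + 1) < e by rewrite -ltr_pdivlMr // ltr_wpDl.
have sC : s * C <= s * `|C| by rewrite ler_wpM2l ?ler_norm // ltW.
have := gap _ Kx; have := mz _ Kx; rewrite -(ler_pM2l s0).
move: sC; rewrite /C; have := xu _ Kp; have := xv _ Kq.
by rewrite !dotvDr !dotvZr; lra.
Unshelve. all: by end_near. Qed.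

(** [B + s%:M] is singular only if [- s] is an eigenvalue of [B]; the [n.+1] candidates
    [r / k.+2%:R] cannot all yield roots of a polynomial of degree [n]. *)
Lemma near_unitmx (R : realType) n (B : 'M[R]_n) r :
  0 < r -> exists2 s, 0 < s < r & B + s%:M \in unitmx.
Proof.
move=> r0; apply: contrapT => H.
pose f k : R := - (r / k.+2%:R).
have root_f k : root (char_poly B) (f k).
  rewrite -eigenvalue_root_char; apply: contrapT => NB; apply: H.
  exists (r / k.+2%:R).
    rewrite divr_gt0 //= ltr_pdivrMr ?ltr0n //.
    by rewrite ltr_pMr // ltr1n.
  move: NB; rewrite /eigenvalue /eigenspace /f raddfN opprK => /negP.
  by rewrite negbK -mxrank_eq0 mxrank_ker subn_eq0 -row_full_unit col_leq_rank.
have := @max_poly_roots _ (char_poly B) (map f (iota 0 n.+1)).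
rewrite monic_neq0 ?char_poly_monic // size_map size_iota size_char_poly ltnn.
suff -> : uniq (map f (iota 0 n.+1)).
  have -> : all (root (char_poly B)) (map f (iota 0 n.+1)).
    by apply/allP => _ /mapP[k _ ->].
  by move=> /(_ isT isT isT).
rewrite map_inj_uniq ?iota_uniq // => i j /oppr_inj.
move=> /(mulfI (lt0r_neq0 r0)) /invr_inj /eqP.
by rewrite eqr_nat => /eqP[].
Qed.

Lemma sum_indicator (R : nzRingType) (I : finType) (k : I) :
  \sum_i (i == k)%:R = 1 :> R.
Proof. by rewrite (bigD1 k) //= eqxx big1 ?addr0 // => i /negPf ->. Qed.

(** * The circumscribed simplex with its facets pushed inwards *)

Section ShrunkenSimplex.
Variables (R : realType) (n : nat) (K : set 'rV[R]_n.+1).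
Variables (u : 'I_n.+2 -> 'rV[R]_n.+1) (h : 'I_n.+2 -> R) (e : R).
Hypotheses (K0 : K !=set0) (sum_u : \sum_i u i = 0).
Hypothesis u_basis : \matrix_j u (lift ord0 j) \in unitmx.
Hypothesis h_max : forall i, exists2 p, K p & dotv p (u i) = h i.
Hypothesis h_ub : forall i x, K x -> dotv x (u i) <= h i.
Hypothesis e0 : 0 < e.
Hypothesis h_gap : forall i j x, i != j -> K x ->
  dotv x (u i) + dotv x (u j) + e <= h i + h j.

Let sum_dotv x : \sum_i dotv x (u i) = 0.
Proof. by rewrite -dotv_sumr sum_u dotvC dotv0l. Qed.

(** The basis [u (lift ord0 j)] determines [t]; the equation at [ord0] follows because both sides
    sum to [0]. *)
Lemma solve_dotv (b : 'I_n.+2 -> R) :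
  \sum_i b i = 0 -> exists t, forall i, dotv t (u i) = b i.
Proof.
move=> sum_b; pose B := \matrix_j u (lift ord0 j).
pose t := (invmx B *m \col_j b (lift ord0 j))^T.
have tb j : dotv t (u (lift ord0 j)) = b (lift ord0 j).
  rewrite dotvC dotvE trmxK -[u _](rowK (fun j => u (lift ord0 j))) -/B.
  by rewrite -row_mul mulmxA mulmxV // mul1mx !mxE.
exists t => i; have [->|] := eqVneq i ord0; last first.
  by rewrite eq_sym => /unlift_some[j -> _].
have := etrans (sum_dotv t) (esym sum_b); rewrite !(big_ord_recl n.+1).
rewrite (eq_bigr (fun j => b (lift ord0 j))) => [|j _ //].
exact: addIr.
Qed.

Lemma dotv_inj x y : (forall i, dotv x (u i) = dotv y (u i)) -> x = y.
Proof.
move=> xy; apply: trmx_inj; pose B := \matrix_j u (lift ord0 j).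
apply: (can_inj (mulKmx u_basis)); apply/colP => j.
have E z : (B *m z^T) j 0 = dotv z (u (lift ord0 j)).
  by rewrite dotvC dotvE -[u _](rowK (fun j => u (lift ord0 j))) -/B -row_mul [RHS]mxE.
by rewrite !E.
Qed.

(** Chosen so that pushing all [n.+2] facets inwards costs [e / 2] in total, half of the gap. *)
Let eta := e / (2 * n.+2%:R).
Let N0 : 0 < n.+2%:R :> R. Proof. by rewrite ltr0n. Qed.
Let eta0 : 0 < eta. Proof. by rewrite divr_gt0 // mulr_gt0. Qed.
Let etaN : n.+2%:R * eta = e / 2.
Proof. by rewrite /eta; move: N0; move: _%:R => a a0; field; rewrite gt_eqF. Qed.
Let width := \sum_i h i - n.+2%:R * eta.

(** As the [u i] sum to [0], [\sum_i h i] is the total slack of any point of [K], and by the gap two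
    facets alone contribute at least [e]. *)
Let width0 : 0 < width.
Proof.
rewrite /width etaN; have [x Kx] := K0.
have : 0 <= \sum_(i : 'I_n) (h (lift ord0 (lift ord0 i))
                 - dotv x (u (lift ord0 (lift ord0 i)))).
  by apply: sumr_ge0 => i _; rewrite subr_ge0 h_ub.
rewrite sumrB; have := sum_dotv x; rewrite !big_ord_recl => Sx.
have := h_gap (isT : ord0 != lift ord0 ord0) Kx.
by move: Sx e0; lra.
Qed.

Let facet i y := dotv y (u i) <= h i - eta.

(** Vertex [v k] lies on every facet but the [k]-th, where its slack is [width]; the barycentric
    coordinates of [y] are its slacks divided by [width]. *)
Lemma facets_simplex :
  exists2 S, is_simplex S & forall y, S y <-> forall i, facet i y.
Proof.
have /choice[v vP] k : exists v, forall i,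
    dotv v (u i) = h i - eta - width * (i == k)%:R.
  apply: solve_dotv; rewrite !sumrB -[X in _ - X]mulr_sumr sum_indicator.
  by rewrite sumr_const card_ord -mulr_natl /width; ring.
have comb (c : 'I_n.+2 -> R) i : dotv (\sum_k c k *: v k) (u i) =
    (h i - eta) * \sum_k c k - width * c i.
  rewrite dotv_suml mulr_sumr.
  rewrite (eq_bigr (fun k => (h i - eta) * c k - width * (c k * (i == k)%:R))).
    rewrite sumrB -[X in _ - X = _]mulr_sumr; congr (_ - _ * _).
    rewrite (bigD1 i) //= eqxx mulr1 big1 ?addr0 // => k.
    by rewrite eq_sym => /negPf ->; rewrite mulr0.
  by move=> k _; rewrite dotvZl vP; ring.
exists (conv_hull v).
  exists v; split=> // c c0 cv i; have := comb c i.
  rewrite c0 cv dotv0l mulr0 sub0r => /esym/eqP.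
  by rewrite oppr_eq0 mulf_eq0 gt_eqF //= => /eqP.
move=> y; split=> [[c [c0 [c1 ->]]] i|Fy].
  by rewrite /facet comb c1 mulr1 gerBl mulr_ge0 // ltW.
pose c i := (h i - eta - dotv y (u i)) / width.
have c1 : \sum_i c i = 1.
  rewrite -mulr_suml !sumrB sum_dotv subr0 sumr_const card_ord -mulr_natl.
  by rewrite divff // gt_eqF.
exists c; split=> [i|]; first by apply: divr_ge0; [rewrite subr_ge0; exact: Fy|exact: ltW].
split=> //; apply: dotv_inj => i; rewrite comb c1 /c.
by field; rewrite gt_eqF.
Qed.

(* [i0] maximizes [|w . u_i|].  The translation [t] pushes every facet but [i0]
   inwards by [eta]; when [x] is close to the facet [i0], moving along [w]
   repairs that facet, at the cost of at most [n.+2 * eta] on the others. *)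
Lemma shadow_translate w : w != 0 ->
  exists t, forall x, K x -> exists s, forall i, facet i (x + t + s *: w).
Proof.
move=> w0; pose b i := dotv w (u i).
have [i0 _ b_max] := @Order.TotalTheory.arg_maxP _ _ _ ord0 predT (fun i => `|b i|) isT.
have bi0 : b i0 != 0.
  apply: contra w0 => /eqP bi0; apply/eqP/dotv_inj => i.
  rewrite dotv0l; apply/eqP; rewrite -normr_le0.
  by have := b_max i isT; rewrite bi0 normr0.
have [|t tP] := @solve_dotv (fun i => n.+2%:R * eta * (i == i0)%:R - eta).
  rewrite sumrB -[X in X - _]mulr_sumr sum_indicator.
  by rewrite sumr_const card_ord -mulr_natl; ring.
exists t => x Kx.
(* The shift by [t] and the inward push together use up [n.+2%:R * eta = e / 2] of the slack at
   [i0]. *)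
have [far|near_i0] := leP (e / 2) (h i0 - dotv x (u i0)).
  exists 0 => i; rewrite /facet scale0r addr0 dotvDl tP.
  have [->|_] := eqVneq i i0; first by rewrite mulr1 etaN; move: far; lra.
  by have := h_ub i Kx; rewrite mulr0; lra.
exists (- (n.+2%:R * eta / b i0)) => i.
rewrite /facet !dotvDl dotvZl tP -/(b i).
have [->|ni] := eqVneq i i0.
  by rewrite mulr1 mulNr divfK //; have := h_ub i0 Kx; lra.
have : - (n.+2%:R * eta / b i0) * b i <= n.+2%:R * eta.
  rewrite mulNr -mulrN -[leLHS]mulrA -[leRHS]mulr1 ler_wpM2l //.
    by rewrite etaN divr_ge0 // ltW.
  apply: le_trans (ler_norm _) _.
  rewrite normrM normfV normrN mulrC ler_pdivrMr ?normr_gt0 // mul1r.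
  exact: b_max.
(* With [x] near the facet [i0], the gap leaves a slack above [e / 2] at every other facet, which
   pays for the slide along [w]. *)
have := h_gap ni Kx; rewrite mulr0 etaN.
by move: near_i0 e0; lra.
Qed.

Lemma shrunken_simplex : exists S : set 'rV[R]_n.+1, is_simplex S /\
    (forall w : 'rV[R]_n.+1, unit_vec w ->
       contains_translate (proj_perp w @` S) (proj_perp w @` K)) /\
    ~ contains_translate S K.
Proof.
have [S simS SP] := facets_simplex; exists S; split=> //; split.
  move=> w w1.
  have [|t tP] := @shadow_translate w.
    apply/eqP => w0; move: w1; rewrite /unit_vec w0 dotv0l => /esym/eqP.
    by rewrite oner_eq0.
  exists (proj_perp w t) => _ [x Kx <-]; have [s sP] := tP x Kx.
  (* The slide along [w] vanishes in the projection. *)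
  exists (x + t + s *: w); first by apply/SP.
  rewrite /proj_perp !dotvDl dotvZl w1 mulr1 !scalerDl.
  by rewrite !opprD !addrA; apply/rowP => i; rewrite !mxE; ring.
move=> [t tP].
(* A translate of [K] inside [S] satisfies [h i + dotv t (u i) <= h i - eta]; summing over [i]
   eliminates [t]. *)
have : \sum_i (h i + dotv t (u i)) <= \sum_i (h i - eta).
  apply: ler_sum => i _; have [p Kp hp] := h_max i.
  by rewrite -{1}hp -dotvDl; exact: (SP _).1 (tP _ Kp) i.
rewrite sumrB big_split /= sum_dotv addr0 sumr_const card_ord -mulr_natl etaN.
by move: e0; lra.
Qed.

End ShrunkenSimplex.

(** * Directions with sum zero and pairwise disjoint faces *)

(* Starting from exposing directions [v i] of distinct points [p i], let [p k]
   be lowest in direction [v ord0] among the [p j], [j != ord0].  For small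
   [s > 0] take [u j = s v_j] for [j != ord0], except that [- v ord0] is added
   to [u k].  No [p j] with [j != k] maximizes [u k], since [p k] beats it on
   both summands; and [u ord0 = - \sum_j u j] is close to [v ord0]. *)
Lemma balanced_directions (R : realType) n (K : set 'rV[R]_n.+1)
    (p v : 'I_n.+2 -> 'rV[R]_n.+1) :
  compact K -> injective p ->
  (forall i, maximizer K (v i) (p i)) ->
  (forall i x, maximizer K (v i) x -> x = p i) ->
  exists u : 'I_n.+2 -> 'rV[R]_n.+1, \sum_i u i = 0 /\
    forall i j, i != j -> disjoint_faces K (u i) (u j).
Proof.
move=> cK inj_p mp unique_p.
have K0 : K !=set0 by exists (p ord0); case: (mp ord0).
have Dv i j : i != j -> disjoint_faces K (v i) (v j).
  move=> ij x /unique_p -> /unique_p /inj_p /eqP.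
  by rewrite (negPf ij).
have strict i y : K y -> y <> p i -> dotv y (v i) < dotv (p i) (v i).
  have [Kp mpi] := mp i; move=> Ky yp; rewrite lt_neqAle mpi // andbT.
  apply/eqP => yi; apply: yp; apply: unique_p; split=> // z Kz.
  by rewrite yi; exact: mpi.
pose one : 'I_n.+2 := lift ord0 ord0.
have [k k0 k_min] := @Order.TotalTheory.arg_minP _ _ _ one
  (fun j => j != ord0) (fun j => dotv (p j) (v ord0)) isT.
have Dk : disjoint_faces K (v ord0) (- v ord0).
  move=> x /unique_p -> [_ /(_ _ (mp k).1)]; rewrite !dotvNr lerN2 leNgt.
  by rewrite strict //; [case: (mp k)|move/inj_p/eqP; rewrite (negPf k0)].
pose w j : 'rV[R]_n.+1 := if j == k then - v ord0 else 0.
pose X := \sum_j v (lift ord0 j).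
(* Positive scaling keeps faces, so [s *: v j] with [j != k] is replaced by [v j]; each pair then
   perturbs [v ord0] against [v j] or [- v ord0]. *)
have small : \forall s \near 0^'+, (forall j : 'I_n.+2, j != ord0 ->
    disjoint_faces K (v ord0 + s *: - X)
      ((if j == k then - v ord0 else v j) + s *: (if j == k then v k else 0))).
  apply: filter_forall => j; have [->|j0] := eqVneq j ord0.
    by near=> s.
  near=> s => _; near: s; apply: disjoint_faces_near => //.
  by have [_|_] := eqVneq j k; [exact: Dk|apply: Dv; rewrite eq_sym].
near (0 : R)^'+ => s.
have s0 : 0 < s by near: s; exact: nbhs_right_gt.
have small_s (j : 'I_n.+2) : j != ord0 -> disjoint_faces K (v ord0 + s *: - X)
    ((if j == k then - v ord0 else v j) + s *: (if j == k then v k else 0)).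
  by move: j; near: s.
pose U j : 'rV[R]_n.+1 := s *: v j + w j.
have Dj i j : i != k -> j != i -> j != ord0 -> i != ord0 ->
    disjoint_faces K (U i) (U j).
  move=> ik ji j0 i0; rewrite {1}/U /w (negPf ik) addr0.
  move=> x /(maximizerZ s0) xi; have [jk|jk] := eqVneq j k; last first.
    rewrite /U /w (negPf jk) addr0 => /(maximizerZ s0).
    by apply: Dv xi; rewrite eq_sym.
  rewrite {x xi}(unique_p _ _ xi) => -[_ /(_ _ (mp k).1)].
  rewrite /U /w jk eqxx !dotvDr !dotvZr !dotvNr leNgt => /negP; apply.
  have := k_min _ i0; have : dotv (p i) (v k) < dotv (p k) (v k).
    by apply: strict => [|/inj_p/eqP]; [case: (mp i)|rewrite (negPf ik)].
  by rewrite -(ltr_pM2l s0); lra.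
have D0 j : j != ord0 -> disjoint_faces K (v ord0 + s *: - X) (U j).
  move=> j0; have := small_s _ j0.
  rewrite /U /w; have [->|_] := eqVneq j k; first by rewrite [- _ + _]addrC.
  rewrite scaler0 !addr0 => D x xm /(maximizerZ s0); exact: D xm.
exists (fun j => if j == ord0 then v ord0 + s *: - X else U j); split.
  have sum_w : \sum_j w (lift ord0 j) = - v ord0.
    have : \sum_j w j = - v ord0 by rewrite -big_mkcond big_pred1_eq.
    by rewrite big_ord_recl /w eq_sym (negPf k0) add0r.
  rewrite big_ord_recl eqxx (eq_bigr (fun j => U (lift ord0 j))) // big_split /=.
  by rewrite -scaler_sumr -/X sum_w scalerN [v ord0 + _]addrC addrACA addNr addrN addr0.
move=> i j ij.
have [i0|i0] := eqVneq i ord0.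
  have j0 : j != ord0 by rewrite -i0 eq_sym.
  by rewrite (negPf j0); exact: D0.
have [j0|j0] := eqVneq j ord0; first exact/disjoint_faces_sym/D0.
have [ik|ik] := eqVneq i k; last by apply: Dj; rewrite // eq_sym.
by apply/disjoint_faces_sym/Dj; rewrite // -ik eq_sym.
Unshelve. all: by end_near. Qed.

(** * From exposed points to the simplex *)

Theorem theorem3p4 (R : realType) (n : nat) (K : set 'rV[R]_n) :
  compact K -> convex_set K ->
  (exists p : 'I_n.+1 -> 'rV[R]_n, injective p /\
     forall i, exposed_point K (p i)) ->
  exists S : set 'rV[R]_n, is_simplex S /\
    (forall u : 'rV[R]_n, unit_vec u ->
       contains_translate (proj_perp u @` S) (proj_perp u @` K)) /\
    ~ contains_translate S K.
Proof.
move=> cK _ [p [inj_p exp_p]].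
(* In dimension [0] there is no unit vector, hence no exposed point. *)
case: n => [|n] in K cK p inj_p exp_p *.
  have [_ [u [/eqP]]] := exp_p ord0.
  by rewrite /dotv big_ord0 eq_sym oner_eq0.
have K0 : K !=set0 by exists (p ord0); case: (exp_p ord0).
have /choice[v vP] i : exists v, maximizer K v (p i) /\
    forall x, maximizer K v x -> x = p i.
  have [Kp [v [_ [mp unique_p]]]] := exp_p i; exists v; split=> // x [Kx mx].
  by apply: unique_p => //; apply/le_anti; rewrite mp //= mx.
have [i|i x|u0 [sum_u0 D0]] := balanced_directions (v := v) cK inj_p.
- exact: (vP i).1.
- exact: (vP i).2.
(* Moving along [d] keeps the sum [0] and adds [s%:M] to the matrix of the last [n.+1] directions,
   so a small [s] makes them a basis. *)
pose d (i : 'I_n.+2) : 'rV[R]_n.+1 :=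
  if unlift ord0 i is Some j then delta_mx 0 j else - \sum_j delta_mx 0 j.
have d_lift j : d (lift ord0 j) = delta_mx 0 j by rewrite /d liftK.
have sum_d : \sum_i d i = 0.
  by rewrite big_ord_recl (eq_bigr _ (fun j _ => d_lift j)) /d unlift_none addNr.
have [r r0 Dr] : exists2 r, 0 < r & forall s, 0 < s < r ->
    forall i j, i != j -> disjoint_faces K (u0 i + s *: d i) (u0 j + s *: d j).
  suff : \forall s \near (0 : R)^'+, forall i j, i != j ->
      disjoint_faces K (u0 i + s *: d i) (u0 j + s *: d j).
    move=> [r /= r0 Dr]; exists r => // s /andP[s0 sr].
    by apply: Dr => //=; rewrite sub0r normrN gtr0_norm.
  apply: filter_forall => i; apply: filter_forall => j.
  have [_|ij] := eqVneq i j; first by near=> s.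
  by near=> s => _; near: s; apply: disjoint_faces_near => //; exact: D0.
have [s /Dr{}Dr unit_u] := near_unitmx (\matrix_j u0 (lift ord0 j)) r0.
pose u i := u0 i + s *: d i.
have /choice[q mq] i : exists q, maximizer K (u i) q by exact: maximizer_exists.
(* Finitely many pairs [i], [j] share one gap. *)
have [e [e0 gap]] : exists e, 0 < e /\ forall i j, i != j -> forall x, K x ->
    dotv x (u i) + dotv x (u j) + e <= dotv (q i) (u i) + dotv (q j) (u j).
  near (0 : R)^'+ => e; exists e; split; first by near: e; exact: nbhs_right_gt.
  near: e; apply: filter_forall => i; apply: filter_forall => j.
  have [_|ij] := eqVneq i j; first by near=> e.
  have [e e0 gap] := disjoint_faces_gap cK (mq i) (mq j) (Dr _ _ ij).
  near=> e' => _ x Kx; apply: le_trans (gap _ Kx).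
  by rewrite lerD2l; near: e'; exact: nbhs_right_le.
apply: (shrunken_simplex (u := u) (h := fun i => dotv (q i) (u i)) K0 _ _ _ _ e0).
- by rewrite big_split /= sum_u0 -scaler_sumr sum_d scaler0 addr0.
- suff -> : \matrix_j u (lift ord0 j) = \matrix_j u0 (lift ord0 j) + s%:M by [].
  apply/matrixP => i j; rewrite !mxE d_lift !mxE eqxx /= [j == i]eq_sym.
  by rewrite mulr_natr.
- by move=> i; exists (q i) => //; case: (mq i).
- by move=> i x; case: (mq i) => _; exact.
- by move=> i j x ij; exact: gap.
Unshelve. all: by end_near. Qed.
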